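(* Let $(R,P_R)$ be a commutative Rota-Baxter algebra (of weight $\lambda$) and let $S\subseteq R$ be a multiplicative subset. Let $S^{-1}R$ be the usual localization of the commutative algebra $R$ at $S$, and let $(\mathrm{Sha}(S^{-1}R),P_{\mathrm{Sha}(S^{-1}R)})$ be the free commutative Rota-Baxter algebra on the algebra $S^{-1}R$. Let $I_{S^{-1}R}$ be the Rota-Baxter ideal of $\mathrm{Sha}(S^{-1}R)$ generated by the set $$\{P_R(a)-1\otimes a \mid a\in R\},$$ where $P_R(a)\in R$ and $1\otimes a\in R^{\otimes 2}$ are identified with their images in $S^{-1}R$ and $(S^{-1}R)^{\otimes 2}$. Let $(\mathrm{Sha}(S^{-1}R)/I_{S^{-1}R},\overline{P_{\mathrm{Sha}(S^{-1}R)}})$ be the corresponding quotient Rota-Baxter algebra, and let $$i:(R,P_R)\to(\mathrm{Sha}(S^{-1}R)/I_{S^{-1}R},\overline{P_{\mathrm{Sha}(S^{-1}R)}})$$ send $a\in R$ to the class of $a$ (the class of the image of $a$ in $S^{-1}R\subseteq \mathrm{Sha}(S^{-1}R)$). Then the triple $(\mathrm{Sha}(S^{-1}R)/I_{S^{-1}R},\overline{P_{\mathrm{Sha}(S^{-1}R)}},i)$ is the Rota-Baxter localization of $(R,P_R)$ at $S$.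
   Context: $\mathbf{k}$ is a commutative unitary ring, $\lambda\in\mathbf{k}$ is fixed, and all algebras are commutative unital $\mathbf{k}$-algebras. A Rota-Baxter algebra of weight $\lambda$ is a pair $(R,P)$ with $R$ an algebra and $P:R\to R$ a $\mathbf{k}$-linear map satisfying $P(x)P(y)=P(xP(y)+P(x)y+\lambda xy)$ for all $x,y\in R$. A morphism $f:(R,P)\to(R',P')$ is an algebra homomorphism with $f\circ P=P'\circ f$. A Rota-Baxter ideal is an ideal closed under $P$; the quotient by a Rota-Baxter ideal $I$ carries the operator $\overline{P}(\overline{a})=\overline{P(a)}$. All Rota-Baxter algebras have the same weight $\lambda$. Rota-Baxter localization: for a multiplicative subset $S\subseteq R$, it is a commutative Rota-Baxter algebra $(S^{-1}_{RB}R,S^{-1}P)$ with a Rota-Baxter homomorphism $i_S:R\to S^{-1}_{RB}R$ such that (1) the elements of $i_S(S)$ are invertible; (2) for every commutative Rota-Baxter algebra $(R',P_{R'})$ and Rota-Baxter homomorphism $f:R\to R'$ such that $f(S)$ consists of invertible elements, there is a unique Rota-Baxter homomorphism $f_S:S^{-1}_{RB}R\to R'$ with $f_S\circ i_S=f$. Free commutative Rota-Baxter algebra on a commutative algebra $A$: $\mathrm{Sha}(A)=\bigoplus_{k\ge 1}A^{\otimes k}$ (tensor over $\mathbf{k}$), with product $\diamond$ defined on $\mathfrak a=a_0\otimes\cdots\otimes a_m$, $\mathfrak b=b_0\otimes\cdots\otimes b_n$ by: $\mathfrak a\diamond\mathfrak b=(a_0b_0)\otimes b_1\otimes\cdots\otimes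 b_n$ if $m=0$; $\mathfrak a\diamond\mathfrak b=(a_0b_0)\otimes a_1\otimes\cdots\otimes a_m$ if $n=0$; and for $m,n>0$, inductively, $$\mathfrak a\diamond\mathfrak b=(a_0b_0)\otimes\big((a_1\otimes\cdots\otimes a_m)\diamond(1\otimes b_1\otimes\cdots\otimes b_n)+(1\otimes a_1\otimes\cdots\otimes a_m)\diamond(b_1\otimes\cdots\otimes b_n)+\lambda(a_1\otimes\cdots\otimes a_m)\diamond(b_1\otimes\cdots\otimes b_n)\big).$$ Its Rota-Baxter operator is $P_{\mathrm{Sha}(A)}(x_0\otimes\cdots\otimes x_n)=1\otimes x_0\otimes\cdots\otimes x_n$. It is the free commutative Rota-Baxter algebra of weight $\lambda$ on $A$ (left adjoint to the forgetful functor to commutative algebras). *)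

(* Defs.v *)
From HB Require Import structures.
From mathcomp Require Import all_boot all_algebra ring.
From mathcomp Require Import boolp classical_sets.
Set Implicit Arguments.
Unset Strict Implicit.
Unset Printing Implicit Defensive.
Import GRing.Theory.
Local Open Scope quotient_scope.
Local Open Scope ring_scope.

(* Commutative unital k-algebras.  The library's comAlgType imposes 1 != 0, *)
(* but a localization, or a quotient by a Rota-Baxter ideal, may be zero;   *)
(* and Hierarchy Builder does not allow a join of ComPzRing and Lmodule,    *)
(* so that the module structure is recovered by the instance below.         *)
HB.mixin Record isPzAlgebra (k : comPzRingType) A of GRing.ComPzRing A := {
  pzscale : k -> A -> A;
  pzscaleA : forall a b x, pzscale a (pzscale b x) = pzscale (a * b) x;
  pzscale1 : forall x, pzscale 1 x = x;
  pzscaleDr : forall a x y, pzscale a (x + y) = pzscale a x + pzscale a y;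
  pzscaleDl : forall x a b, pzscale (a + b) x = pzscale a x + pzscale b x;
  pzscaleAl : forall a x y, pzscale a (x * y) = pzscale a x * y
}.

#[short(type="comPzAlgType")]
HB.structure Definition ComPzAlgebra (k : comPzRingType) :=
  {A of GRing.ComPzRing A & isPzAlgebra k A}.

HB.instance Definition _ (k : comPzRingType) (A : comPzAlgType k) :=
  GRing.Zmodule_isLmodule.Build k (ComPzAlgebra.sort A)
    pzscaleA pzscale1 pzscaleDr (fun x a b => pzscaleDl x a b).

Lemma pzscalerAl (k : comPzRingType) (A : comPzAlgType k) (c : k) (x y : A) :
  c *: (x * y) = (c *: x) * y.
Proof. exact: pzscaleAl. Qed.

Lemma pzscalerAr (k : comPzRingType) (A : comPzAlgType k) (c : k) (x y : A) :
  c *: (x * y) = x * (c *: y).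
Proof. by rewrite mulrC pzscalerAl mulrC. Qed.

Definition rota_baxter (k : comPzRingType) (lam : k) (R : comPzAlgType k)
    (P : {linear R -> R}) : Prop :=
  forall x y, P x * P y = P (x * P y + P x * y + lam *: (x * y)).

(* A ring morphism f is a morphism of k-algebras when moreover scalable f. *)
Definition rb_morphism (k : comPzRingType) (R R' : comPzAlgType k)
    (P : {linear R -> R}) (P' : {linear R' -> R'})
    (f : {rmorphism R -> R'}) : Prop :=
  scalable f /\ forall x, f (P x) = P' (f x).

Record rb_ideal (k : comPzRingType) (A : comPzAlgType k)
    (P : {linear A -> A}) := RBIdeal {
  rb_ideal_set :> A -> Prop;
  rb_ideal0 : rb_ideal_set 0;
  rb_idealD : forall x y, rb_ideal_set x -> rb_ideal_set y ->
    rb_ideal_set (x + y);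
  rb_idealM : forall a x, rb_ideal_set x -> rb_ideal_set (a * x);
  rb_ideal_op : forall x, rb_ideal_set x -> rb_ideal_set (P x)
}.

Section GeneratedIdeal.
Variables (k : comPzRingType) (A : comPzAlgType k) (P : {linear A -> A}).
Variable X : set A.

Definition rb_gen_set : set A :=
  [set x | forall J : rb_ideal P, (X `<=` (J : A -> Prop))%classic -> J x].

Lemma rb_gen_set0 : rb_gen_set 0.
Proof. by move=> J _; apply: rb_ideal0. Qed.
Lemma rb_gen_setD x y : rb_gen_set x -> rb_gen_set y -> rb_gen_set (x + y).
Proof. by move=> hx hy J hJ; apply: rb_idealD; [apply: hx|apply: hy]. Qed.
Lemma rb_gen_setM a x : rb_gen_set x -> rb_gen_set (a * x).
Proof. by move=> hx J hJ; apply: rb_idealM; apply: hx. Qed.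
Lemma rb_gen_set_op x : rb_gen_set x -> rb_gen_set (P x).
Proof. by move=> hx J hJ; apply: rb_ideal_op; apply: hx. Qed.

Definition rb_gen : rb_ideal P :=
  RBIdeal rb_gen_set0 rb_gen_setD rb_gen_setM rb_gen_set_op.

End GeneratedIdeal.

Section Quotient.
Variables (k : comPzRingType) (A : comPzAlgType k) (P : {linear A -> A}).
Variable I : rb_ideal P.

Definition rbq_rel (x y : A) : bool := `[< I (x - y) >].

Lemma rb_idealZ c x : I x -> I (c *: x).
Proof. by move=> hx; rewrite -[x]mul1r pzscalerAl; apply: rb_idealM. Qed.
Lemma rb_idealN x : I x -> I (- x).
Proof. by rewrite -[- x]mulN1r; apply: rb_idealM. Qed.

Lemma rbq_refl : reflexive rbq_rel.
Proof. by move=> x; apply/asboolP; rewrite subrr; apply: rb_ideal0. Qed.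
Lemma rbq_sym : symmetric rbq_rel.
Proof.
by move=> x y; apply/idP/idP => /asboolP/rb_idealN; rewrite opprB => h;
  apply/asboolP.
Qed.
Lemma rbq_trans : transitive rbq_rel.
Proof.
move=> y x z /asboolP h1 /asboolP h2; apply/asboolP.
by rewrite -[x](subrK y) -addrA; apply: rb_idealD.
Qed.

Canonical rbq_equiv := EquivRel rbq_rel rbq_refl rbq_sym rbq_trans.

Definition rb_quot := {eq_quot rbq_equiv}.
HB.instance Definition _ := Choice.on rb_quot.
HB.instance Definition _ : EqQuotient A rbq_equiv rb_quot :=
  EqQuotient.on rb_quot.

Definition rb_pi : A -> rb_quot := \pi_rb_quot.

Lemma rb_piP x y : (rb_pi x = rb_pi y) <-> I (x - y).
Proof.
split=> [/eqquotP/asboolP //|h].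
by apply/eqquotP; apply/asboolP.
Qed.

Lemma rb_pi_surj q : {x | rb_pi x = q}.
Proof. by exists (repr q); apply: reprK. Qed.

Definition rbq_lift1 (f : A -> A) (q : rb_quot) : rb_quot :=
  rb_pi (f (repr q)).
Definition rbq_lift2 (f : A -> A -> A) (q r : rb_quot) : rb_quot :=
  rb_pi (f (repr q) (repr r)).

Lemma rbq_reprB x : I (repr (rb_pi x) - x).
Proof. by apply/rb_piP; apply: reprK. Qed.

Lemma rbq_lift1E (f : A -> A) x : (forall y z, I (y - z) -> I (f y - f z)) ->
  rbq_lift1 f (rb_pi x) = rb_pi (f x).
Proof. by move=> hf; apply/rb_piP/hf/rbq_reprB. Qed.

Definition rbq_opp := rbq_lift1 -%R.
Definition rbq_add := rbq_lift2 +%R.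
Definition rbq_mul := rbq_lift2 *%R.
Definition rbq_scale c := rbq_lift1 ( *:%R c).

Lemma rbq_oppE x : rbq_opp (rb_pi x) = rb_pi (- x).
Proof. by apply: rbq_lift1E => y z /rb_idealN; rewrite opprB opprK addrC. Qed.
Lemma rbq_scaleE c x : rbq_scale c (rb_pi x) = rb_pi (c *: x).
Proof.
by apply: rbq_lift1E => y z /(rb_idealZ c); rewrite scalerBr.
Qed.
Lemma rbq_addE x y : rbq_add (rb_pi x) (rb_pi y) = rb_pi (x + y).
Proof. by apply/rb_piP; rewrite opprD addrACA; apply: rb_idealD; apply: rbq_reprB. Qed.
Lemma rbq_mulE x y : rbq_mul (rb_pi x) (rb_pi y) = rb_pi (x * y).
Proof.
apply/rb_piP; set u := repr _; set v := repr _.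
have -> : u * v - x * y = u * (v - y) + y * (u - x).
  by rewrite !mulrBr (mulrC y u) subrKA (mulrC y x).
by apply: rb_idealD; apply: rb_idealM; apply: rbq_reprB.
Qed.

Lemma rbq_addA : associative rbq_add.
Proof.
move=> q r s; case: (rb_pi_surj q) (rb_pi_surj r) (rb_pi_surj s).
by move=> x <- [y <-] [z <-]; rewrite !rbq_addE addrA.
Qed.
Lemma rbq_addC : commutative rbq_add.
Proof.
move=> q r; case: (rb_pi_surj q) (rb_pi_surj r) => x <- [y <-].
by rewrite !rbq_addE addrC.
Qed.
Lemma rbq_add0 : left_id (rb_pi 0) rbq_add.
Proof. by move=> q; case: (rb_pi_surj q) => x <-; rewrite rbq_addE add0r. Qed.
Lemma rbq_addN : left_inverse (rb_pi 0) rbq_opp rbq_add.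
Proof.
by move=> q; case: (rb_pi_surj q) => x <-; rewrite rbq_oppE rbq_addE addNr.
Qed.
HB.instance Definition _ :=
  GRing.isZmodule.Build rb_quot rbq_addA rbq_addC rbq_add0 rbq_addN.

Lemma rbq_mulA : associative rbq_mul.
Proof.
move=> q r s; case: (rb_pi_surj q) (rb_pi_surj r) (rb_pi_surj s).
by move=> x <- [y <-] [z <-]; rewrite !rbq_mulE mulrA.
Qed.
Lemma rbq_mulC : commutative rbq_mul.
Proof.
move=> q r; case: (rb_pi_surj q) (rb_pi_surj r) => x <- [y <-].
by rewrite !rbq_mulE mulrC.
Qed.
Lemma rbq_mul1 : left_id (rb_pi 1) rbq_mul.
Proof. by move=> q; case: (rb_pi_surj q) => x <-; rewrite rbq_mulE mul1r. Qed.
Lemma rbq_mulDl : left_distributive rbq_mul rbq_add.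
Proof.
move=> q r s; case: (rb_pi_surj q) (rb_pi_surj r) (rb_pi_surj s).
by move=> x <- [y <-] [z <-]; rewrite rbq_addE !rbq_mulE rbq_addE mulrDl.
Qed.
HB.instance Definition _ :=
  GRing.Zmodule_isComPzRing.Build rb_quot rbq_mulA rbq_mulC rbq_mul1 rbq_mulDl.

Lemma rb_pi_zmod_morphism : zmod_morphism rb_pi.
Proof.
by move=> x y; rewrite -[RHS]/(rbq_add _ (rbq_opp _)) rbq_oppE rbq_addE.
Qed.
HB.instance Definition _ :=
  GRing.isZmodMorphism.Build A rb_quot rb_pi rb_pi_zmod_morphism.
Lemma rb_pi_monoid_morphism : monoid_morphism rb_pi.
Proof. by split=> // x y; rewrite -[RHS]/(rbq_mul _ _) rbq_mulE. Qed.
HB.instance Definition _ :=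
  GRing.isMonoidMorphism.Build A rb_quot rb_pi rb_pi_monoid_morphism.

Lemma rbq_scaleA a b q : rbq_scale a (rbq_scale b q) = rbq_scale (a * b) q.
Proof. by case: (rb_pi_surj q) => x <-; rewrite !rbq_scaleE scalerA. Qed.
Lemma rbq_scale1 q : rbq_scale 1 q = q.
Proof. by case: (rb_pi_surj q) => x <-; rewrite !rbq_scaleE scale1r. Qed.
Lemma rbq_scaleDr a q r :
  rbq_scale a (q + r) = rbq_scale a q + rbq_scale a r.
Proof.
case: (rb_pi_surj q) (rb_pi_surj r) => x <- [y <-].
by rewrite -rmorphD !rbq_scaleE scalerDr rmorphD.
Qed.
Lemma rbq_scaleDl q a b :
  rbq_scale (a + b) q = rbq_scale a q + rbq_scale b q.
Proof.
by case: (rb_pi_surj q) => x <-; rewrite !rbq_scaleE scalerDl rmorphD.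
Qed.
Lemma rbq_scaleAl a q r : rbq_scale a (q * r) = rbq_scale a q * r.
Proof.
case: (rb_pi_surj q) (rb_pi_surj r) => x <- [y <-].
by rewrite -rmorphM !rbq_scaleE pzscalerAl rmorphM.
Qed.
HB.instance Definition _ := GRing.Zmodule_isLmodule.Build k rb_quot
  rbq_scaleA rbq_scale1 rbq_scaleDr (fun q a b => rbq_scaleDl q a b).
HB.instance Definition _ := isPzAlgebra.Build k rb_quot
  rbq_scaleA rbq_scale1 rbq_scaleDr rbq_scaleDl rbq_scaleAl.

Lemma rb_pi_scalable : scalable rb_pi.
Proof. by move=> c x; rewrite -[RHS]/(rbq_scale _ _) rbq_scaleE. Qed.

Definition rb_quot_op : rb_quot -> rb_quot := rbq_lift1 P.

Lemma rb_quot_opE x : rb_quot_op (rb_pi x) = rb_pi (P x).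
Proof. by apply: rbq_lift1E => y z /rb_ideal_op; rewrite linearB. Qed.

Lemma rb_quot_op_linear : linear rb_quot_op.
Proof.
move=> c q r; case: (rb_pi_surj q) (rb_pi_surj r) => x <- [y <-].
rewrite -rb_pi_scalable -rmorphD !rb_quot_opE linearP rmorphD.
by congr (_ + _); apply: rb_pi_scalable.
Qed.
HB.instance Definition _ :=
  GRing.isLinear.Build k rb_quot rb_quot _ rb_quot_op rb_quot_op_linear.

End Quotient.

Section Localization.
Variables (k : comPzRingType) (R : comPzAlgType k) (S : mulrClosed R).

Definition loc_frac : Type := (R * {s : R | s \in S})%type.
HB.instance Definition _ := Choice.on loc_frac.

Definition loc_rel (x y : loc_frac) : bool :=
  `[< exists2 u, u \in S & u * (x.1 * \val y.2) = u * (y.1 * \val x.2) >].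

Lemma loc_refl : reflexive loc_rel.
Proof. by move=> x; apply/asboolP; exists 1; rewrite ?rpred1. Qed.
Lemma loc_sym : symmetric loc_rel.
Proof.
by move=> x y; apply/idP/idP => /asboolP[u Su e]; apply/asboolP; exists u.
Qed.
Lemma loc_trans : transitive loc_rel.
Proof.
move=> [b [t St]] [a [s Ss]] [c [v Sv]] /asboolP[/= u Su e].
move=> /asboolP[/= w Sw e']; apply/asboolP => /=.
exists (u * w * t); first by rewrite !rpredM.
have -> : u * w * t * (a * v) = w * v * (u * (a * t)) by ring.
rewrite e.
have -> : w * v * (u * (b * s)) = u * s * (w * (b * v)) by ring.
by rewrite e'; ring.
Qed.

Canonical loc_equiv := EquivRel loc_rel loc_refl loc_sym loc_trans.

Definition loc := {eq_quot loc_equiv}.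
HB.instance Definition _ := Choice.on loc.
HB.instance Definition _ : EqQuotient loc_frac loc_equiv loc :=
  EqQuotient.on loc.

Definition den_mul (s t : {s : R | s \in S}) : {s : R | s \in S} :=
  exist _ (\val s * \val t) (rpredM (valP s) (valP t)).
Definition den1 : {s : R | s \in S} := exist _ 1 (rpred1 _).

Definition frac (a : R) (s : {s : R | s \in S}) : loc := \pi_loc (a, s).

Lemma fracP a s b t : (frac a s = frac b t) <->
  (exists2 u, u \in S & u * (a * \val t) = u * (b * \val s)).
Proof.
split=> [/eqquotP/asboolP //|h].
by apply/eqquotP; apply/asboolP.
Qed.

Lemma frac_surj q : {p | frac p.1 p.2 = q}.
Proof. by exists (repr q); rewrite /frac -surjective_pairing reprK. Qed.

Definition loc_add (q r : loc) : loc :=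
  let: (a, s) := repr q in let: (b, t) := repr r in
  frac (a * \val t + b * \val s) (den_mul s t).
Definition loc_opp (q : loc) : loc := let: (a, s) := repr q in frac (- a) s.
Definition loc_mul (q r : loc) : loc :=
  let: (a, s) := repr q in let: (b, t) := repr r in
  frac (a * b) (den_mul s t).
Definition loc_scale (c : k) (q : loc) : loc :=
  let: (a, s) := repr q in frac (c *: a) s.

Lemma frac_repr a s : exists2 u, u \in S &
  u * ((repr (frac a s)).1 * \val s) = u * (a * \val (repr (frac a s)).2).
Proof.
by apply/fracP; rewrite {1}/frac -surjective_pairing reprK.
Qed.

Lemma loc_addE a s b t : loc_add (frac a s) (frac b t) =
  frac (a * \val t + b * \val s) (den_mul s t).
Proof.
rewrite /loc_add; case: (frac_repr a s) (frac_repr b t).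
case: (repr _) => a' s'; case: (repr _) => b' t' /= u Su e [v Sv e'].
apply/fracP; exists (u * v); first by rewrite rpredM.
rewrite /=; move: (\val s) (\val s') (\val t) (\val t') e e'.
move=> {s s' t t'} s s' t t' e e'.
transitivity (u * (a' * s) * v * t * t' + v * (b' * t) * u * s * s').
  by ring.
by rewrite e e'; ring.
Qed.

Lemma loc_mulE a s b t : loc_mul (frac a s) (frac b t) =
  frac (a * b) (den_mul s t).
Proof.
rewrite /loc_mul; case: (frac_repr a s) (frac_repr b t).
case: (repr _) => a' s'; case: (repr _) => b' t' /= u Su e [v Sv e'].
apply/fracP; exists (u * v); first by rewrite rpredM.
rewrite /=; move: (\val s) (\val s') (\val t) (\val t') e e'.
move=> {s s' t t'} s s' t t' e e'.
transitivity (u * (a' * s) * (v * (b' * t))); first by ring.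
by rewrite e e'; ring.
Qed.

Lemma loc_oppE a s : loc_opp (frac a s) = frac (- a) s.
Proof.
rewrite /loc_opp; case: (frac_repr a s); case: (repr _) => a' s' /= u Su e.
by apply/fracP; exists u => //; rewrite !mulNr !mulrN e.
Qed.

Lemma loc_scaleE c a s : loc_scale c (frac a s) = frac (c *: a) s.
Proof.
rewrite /loc_scale; case: (frac_repr a s); case: (repr _) => a' s' /= u Su e.
by apply/fracP; exists u => //; rewrite -!pzscalerAl -!pzscalerAr e.
Qed.

Lemma frac_eq a s b t : a * \val t = b * \val s -> frac a s = frac b t.
Proof. by move=> e; apply/fracP; exists 1; rewrite ?rpred1 ?e. Qed.

Lemma loc_addA : associative loc_add.
Proof.
move=> q r p; case: (frac_surj q) (frac_surj r) (frac_surj p).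
move=> [a s] <- [[b t] <-] [[c u] <-]; rewrite !loc_addE.
by apply: frac_eq => /=; ring.
Qed.
Lemma loc_addC : commutative loc_add.
Proof.
move=> q r; case: (frac_surj q) (frac_surj r) => [[a s] <-] [[b t] <-].
by rewrite !loc_addE; apply: frac_eq => /=; ring.
Qed.
Lemma loc_add0 : left_id (frac 0 den1) loc_add.
Proof.
move=> q; case: (frac_surj q) => [[a s] <-]; rewrite loc_addE.
by apply: frac_eq => /=; ring.
Qed.
Lemma loc_addN : left_inverse (frac 0 den1) loc_opp loc_add.
Proof.
move=> q; case: (frac_surj q) => [[a s] <-]; rewrite loc_oppE loc_addE.
by apply: frac_eq => /=; ring.
Qed.
HB.instance Definition _ :=
  GRing.isZmodule.Build loc loc_addA loc_addC loc_add0 loc_addN.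

Lemma loc_mulA : associative loc_mul.
Proof.
move=> q r p; case: (frac_surj q) (frac_surj r) (frac_surj p).
move=> [a s] <- [[b t] <-] [[c u] <-]; rewrite !loc_mulE.
by apply: frac_eq => /=; ring.
Qed.
Lemma loc_mulC : commutative loc_mul.
Proof.
move=> q r; case: (frac_surj q) (frac_surj r) => [[a s] <-] [[b t] <-].
by rewrite !loc_mulE; apply: frac_eq => /=; ring.
Qed.
Lemma loc_mul1 : left_id (frac 1 den1) loc_mul.
Proof.
move=> q; case: (frac_surj q) => [[a s] <-]; rewrite loc_mulE.
by apply: frac_eq => /=; ring.
Qed.
Lemma loc_mulDl : left_distributive loc_mul loc_add.
Proof.
move=> q r p; case: (frac_surj q) (frac_surj r) (frac_surj p).
move=> [a s] <- [[b t] <-] [[c u] <-]; rewrite loc_addE !loc_mulE loc_addE.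
by apply: frac_eq => /=; ring.
Qed.
HB.instance Definition _ :=
  GRing.Zmodule_isComPzRing.Build loc loc_mulA loc_mulC loc_mul1 loc_mulDl.

Lemma fracD a s b t :
  frac a s + frac b t = frac (a * \val t + b * \val s) (den_mul s t).
Proof. exact: loc_addE. Qed.
Lemma fracM a s b t : frac a s * frac b t = frac (a * b) (den_mul s t).
Proof. exact: loc_mulE. Qed.

Lemma loc_scaleA a b q : loc_scale a (loc_scale b q) = loc_scale (a * b) q.
Proof. by case: (frac_surj q) => [[x s] <-]; rewrite !loc_scaleE scalerA. Qed.
Lemma loc_scale1 q : loc_scale 1 q = q.
Proof. by case: (frac_surj q) => [[x s] <-]; rewrite !loc_scaleE scale1r. Qed.
Lemma loc_scaleDr a q r :
  loc_scale a (q + r) = loc_scale a q + loc_scale a r.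
Proof.
case: (frac_surj q) (frac_surj r) => [[x s] <-] [[y t] <-].
rewrite fracD !loc_scaleE fracD.
by rewrite scalerDr !pzscalerAl.
Qed.
Lemma loc_scaleDl q a b :
  loc_scale (a + b) q = loc_scale a q + loc_scale b q.
Proof.
case: (frac_surj q) => [[x s] <-]; rewrite !loc_scaleE fracD.
by apply: frac_eq => /=; rewrite scalerDl; ring.
Qed.
Lemma loc_scaleAl a q r : loc_scale a (q * r) = loc_scale a q * r.
Proof.
case: (frac_surj q) (frac_surj r) => [[x s] <-] [[y t] <-].
by rewrite fracM !loc_scaleE fracM pzscalerAl.
Qed.
HB.instance Definition _ := GRing.Zmodule_isLmodule.Build k loc
  loc_scaleA loc_scale1 loc_scaleDr (fun q a b => loc_scaleDl q a b).
HB.instance Definition _ := isPzAlgebra.Build k loc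
  loc_scaleA loc_scale1 loc_scaleDr loc_scaleDl loc_scaleAl.

Definition loc_inj (a : R) : loc := frac a den1.

Lemma loc_inj_zmod_morphism : zmod_morphism loc_inj.
Proof.
move=> a b; rewrite -[RHS]/(loc_add _ (loc_opp _)) loc_oppE loc_addE.
by apply: frac_eq => /=; ring.
Qed.
HB.instance Definition _ :=
  GRing.isZmodMorphism.Build R loc loc_inj loc_inj_zmod_morphism.
Lemma loc_inj_monoid_morphism : monoid_morphism loc_inj.
Proof.
split=> // a b; rewrite -[RHS]/(loc_mul _ _) loc_mulE.
by apply: frac_eq => /=; ring.
Qed.
HB.instance Definition _ :=
  GRing.isMonoidMorphism.Build R loc loc_inj loc_inj_monoid_morphism.
Lemma loc_inj_scalable : scalable loc_inj.
Proof. by move=> c a; symmetry; apply: loc_scaleE. Qed.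
End Localization.

Definition bilin (k : comPzRingType) (M N Q : lmodType k) (f : M -> N -> Q) :=
  (forall y, linear (f^~ y)) /\ (forall x, linear (f x)).

Section Tensor.
Variables (k : comPzRingType) (M N : lmodType k).

(* A list of pairs stands for the formal sum of the pure tensors x (x) y; *)
(* tens_eqv is the congruence generated by bilinearity.                   *)
Inductive tens_eqv : seq (M * N) -> seq (M * N) -> Prop :=
| tens_eqv_refl s : tens_eqv s s
| tens_eqv_sym s t : tens_eqv s t -> tens_eqv t s
| tens_eqv_trans s t u : tens_eqv s t -> tens_eqv t u -> tens_eqv s u
| tens_eqv_cat s s' t t' :
    tens_eqv s s' -> tens_eqv t t' -> tens_eqv (s ++ t) (s' ++ t')
| tens_eqv_catC s t : tens_eqv (s ++ t) (t ++ s)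
| tens_eqv_0 y : tens_eqv [:: (0, y)] [::]
| tens_eqv_Dl x x' y : tens_eqv [:: (x + x', y)] [:: (x, y); (x', y)]
| tens_eqv_Dr x y y' : tens_eqv [:: (x, y + y')] [:: (x, y); (x, y')]
| tens_eqv_Z c x y : tens_eqv [:: (c *: x, y)] [:: (x, c *: y)].

Definition tens_rel (s t : seq (M * N)) : bool := `[< tens_eqv s t >].

Lemma tens_rel_refl : reflexive tens_rel.
Proof. by move=> s; apply/asboolP; apply: tens_eqv_refl. Qed.
Lemma tens_rel_sym : symmetric tens_rel.
Proof.
by move=> s t; apply/idP/idP => /asboolP h; apply/asboolP; apply: tens_eqv_sym.
Qed.
Lemma tens_rel_trans : transitive tens_rel.
Proof.
by move=> t s u /asboolP h /asboolP h'; apply/asboolP; apply: tens_eqv_trans h'.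
Qed.

Canonical tens_equiv :=
  EquivRel tens_rel tens_rel_refl tens_rel_sym tens_rel_trans.

Definition tens := {eq_quot tens_equiv}.
HB.instance Definition _ := Choice.on tens.
HB.instance Definition _ : EqQuotient (seq (M * N)) tens_equiv tens :=
  EqQuotient.on tens.

Definition tens_pi (s : seq (M * N)) : tens := \pi_tens s.

Lemma tens_piP s t : (tens_pi s = tens_pi t) <-> tens_eqv s t.
Proof.
split=> [/eqquotP/asboolP //|h].
by apply/eqquotP; apply/asboolP.
Qed.
Lemma tens_pi_surj q : {s | tens_pi s = q}.
Proof. by exists (repr q); apply: reprK. Qed.
Lemma tens_repr s : tens_eqv (repr (tens_pi s)) s.
Proof. by apply/tens_piP; apply: reprK. Qed.

Definition scale_pairs (c : k) (s : seq (M * N)) : seq (M * N) :=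
  [seq (c *: p.1, p.2) | p <- s].

Definition tens_add (q r : tens) : tens := tens_pi (repr q ++ repr r).
Definition tens_scale (c : k) (q : tens) : tens :=
  tens_pi (scale_pairs c (repr q)).
Definition tens_opp : tens -> tens := tens_scale (-1).

Lemma tens_addE s t : tens_add (tens_pi s) (tens_pi t) = tens_pi (s ++ t).
Proof. by apply/tens_piP; apply: tens_eqv_cat; apply: tens_repr. Qed.

Lemma scale_pairs_eqv c s t :
  tens_eqv s t -> tens_eqv (scale_pairs c s) (scale_pairs c t).
Proof.
elim=> {s t} [s|s t _|s t u _ h _ h'|s s' t t' _ h _ h'|s t|y|x x' y|x y y'|
    d x y].
- exact: tens_eqv_refl.
- exact: tens_eqv_sym.
- exact: tens_eqv_trans h'.
- by rewrite /scale_pairs !map_cat; apply: tens_eqv_cat.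
- by rewrite /scale_pairs !map_cat; apply: tens_eqv_catC.
- by rewrite /= scaler0; apply: tens_eqv_0.
- by rewrite /= scalerDr; apply: tens_eqv_Dl.
- exact: tens_eqv_Dr.
- by rewrite /= scalerA mulrC -scalerA; apply: tens_eqv_Z.
Qed.

Lemma tens_scaleE c s : tens_scale c (tens_pi s) = tens_pi (scale_pairs c s).
Proof. by apply/tens_piP; apply: scale_pairs_eqv; apply: tens_repr. Qed.

Lemma tens_addA : associative tens_add.
Proof.
move=> q r p; case: (tens_pi_surj q) (tens_pi_surj r) (tens_pi_surj p).
by move=> s <- [t <-] [u <-]; rewrite !tens_addE catA.
Qed.
Lemma tens_addC : commutative tens_add.
Proof.
move=> q r; case: (tens_pi_surj q) (tens_pi_surj r) => s <- [t <-].
by rewrite !tens_addE; apply/tens_piP; apply: tens_eqv_catC.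
Qed.
Lemma tens_add0 : left_id (tens_pi [::]) tens_add.
Proof. by move=> q; case: (tens_pi_surj q) => s <-; rewrite tens_addE. Qed.

Lemma tens_scaleA a b q :
  tens_scale a (tens_scale b q) = tens_scale (a * b) q.
Proof.
case: (tens_pi_surj q) => s <-; rewrite !tens_scaleE /scale_pairs -map_comp.
by congr tens_pi; apply: eq_map => p /=; rewrite scalerA.
Qed.
Lemma tens_scale1 q : tens_scale 1 q = q.
Proof.
case: (tens_pi_surj q) => s <-; rewrite !tens_scaleE /scale_pairs.
by congr tens_pi; rewrite -[RHS]map_id; apply: eq_map => -[x y] /=;
  rewrite scale1r.
Qed.
Lemma tens_scaleDr a q r :
  tens_scale a (tens_add q r) = tens_add (tens_scale a q) (tens_scale a r).
Proof.
case: (tens_pi_surj q) (tens_pi_surj r) => s <- [t <-].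
by rewrite tens_addE !tens_scaleE tens_addE /scale_pairs map_cat.
Qed.
Lemma tens_scaleDl q a b :
  tens_scale (a + b) q = tens_add (tens_scale a q) (tens_scale b q).
Proof.
case: (tens_pi_surj q) => s <-; rewrite !tens_scaleE tens_addE.
apply/tens_piP; elim: s => [|[x y] s IH] /=; first exact: tens_eqv_refl.
rewrite -cat1s scalerDl; apply: tens_eqv_trans.
  by apply: tens_eqv_cat; [apply: tens_eqv_Dl|apply: IH].
rewrite -[_ :: (_ ++ _)]cat1s -[[:: _; _]]cat1s -catA.
apply: tens_eqv_cat; first exact: tens_eqv_refl.
rewrite catA -(cat1s _ (scale_pairs b s)) catA.
by apply: tens_eqv_cat; [apply: tens_eqv_catC|apply: tens_eqv_refl].
Qed.
Lemma tens_addN : left_inverse (tens_pi [::]) tens_opp tens_add.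
Proof.
move=> q; rewrite -{2}[q]tens_scale1 -tens_scaleDl addNr.
case: (tens_pi_surj q) => s <-; rewrite tens_scaleE; apply/tens_piP.
elim: s => [|[x y] s IH] /=; first exact: tens_eqv_refl.
rewrite -cat1s -[[::]]/([::] ++ [::]) scale0r.
by apply: tens_eqv_cat IH; apply: tens_eqv_0.
Qed.
HB.instance Definition _ :=
  GRing.isZmodule.Build tens tens_addA tens_addC tens_add0 tens_addN.
HB.instance Definition _ := GRing.Zmodule_isLmodule.Build k tens
  tens_scaleA tens_scale1 tens_scaleDr (fun q a b => tens_scaleDl q a b).

Definition tpure (x : M) (y : N) : tens := tens_pi [:: (x, y)].

Lemma tpure_bilin : bilin tpure.
Proof.
split=> [y c x x'|x c y y'].
  rewrite -[RHS]/(tens_add (tens_scale _ _) _) tens_scaleE tens_addE.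
  by apply/tens_piP; apply: tens_eqv_Dl.
rewrite -[RHS]/(tens_add (tens_scale _ _) _) tens_scaleE tens_addE.
apply/tens_piP; apply: tens_eqv_trans; first exact: tens_eqv_Dr.
rewrite -cat1s -[X in tens_eqv _ X]cat1s; apply: tens_eqv_cat.
  by apply: tens_eqv_sym; apply: tens_eqv_Z.
exact: tens_eqv_refl.
Qed.

Lemma tens_piE s : tens_pi s = \sum_(p <- s) tpure p.1 p.2.
Proof.
elim: s => [|[x y] s IH]; first by rewrite big_nil.
by rewrite big_cons -IH -[RHS]/(tens_add _ _) tens_addE.
Qed.

Lemma tens_ind (P : tens -> Prop) : P 0 ->
  (forall q r, P q -> P r -> P (q + r)) -> (forall x y, P (tpure x y)) ->
  forall q, P q.
Proof.
move=> P0 PD Pp q; case: (tens_pi_surj q) => s <-; rewrite tens_piE.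
by elim/big_ind: _.
Qed.

(* The linear map induced by f; meaningful when f is bilinear (tliftE). *)
Definition tlift (Q : lmodType k) (f : M -> N -> Q) (q : tens) : Q :=
  \sum_(p <- repr q) f p.1 p.2.

Section Lift.
Variables (Q : lmodType k) (f : M -> N -> Q) (hf : bilin f).

Lemma bilinDl x x' y : f (x + x') y = f x y + f x' y.
Proof. by have := hf.1 y 1 x x'; rewrite !scale1r. Qed.
Lemma bilinDr x y y' : f x (y + y') = f x y + f x y'.
Proof. by have := hf.2 x 1 y y'; rewrite !scale1r. Qed.
Lemma bilin0l y : f 0 y = 0.
Proof. by apply: (addIr (f 0 y)); rewrite -bilinDl !add0r. Qed.
Lemma bilin0r x : f x 0 = 0.
Proof. by apply: (addIr (f x 0)); rewrite -bilinDr !add0r. Qed.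
Lemma bilinZl c x y : f (c *: x) y = c *: f x y.
Proof. by have := hf.1 y c x 0; rewrite addr0 bilin0l addr0. Qed.
Lemma bilinZr c x y : f x (c *: y) = c *: f x y.
Proof. by have := hf.2 x c y 0; rewrite addr0 bilin0r addr0. Qed.

Lemma tlift_pi s : tlift f (tens_pi s) = \sum_(p <- s) f p.1 p.2.
Proof.
have aux t u : tens_eqv t u ->
    \sum_(p <- t) f p.1 p.2 = \sum_(p <- u) f p.1 p.2.
  elim=> {s t u} //=.
  - by move=> s t u _ -> _ ->.
  - by move=> s s' t t' _ h _ h'; rewrite !big_cat /= h h'.
  - by move=> s t; rewrite !big_cat /= addrC.
  - by move=> y; rewrite big_seq1 big_nil bilin0l.
  - by move=> x x' y; rewrite !big_cons !big_nil !addr0 bilinDl.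
  - by move=> x y y'; rewrite !big_cons !big_nil !addr0 bilinDr.
  - by move=> c x y; rewrite !big_seq1 /= bilinZl bilinZr.
exact: aux (tens_repr s).
Qed.

Lemma tliftE x y : tlift f (tpure x y) = f x y.
Proof. by rewrite tlift_pi big_seq1. Qed.

Lemma tlift_linear : linear (tlift f).
Proof.
move=> c q r; case: (tens_pi_surj q) (tens_pi_surj r) => s <- [t <-].
rewrite -[c *: _]/(tens_scale _ _) tens_scaleE -[_ + _]/(tens_add _ _).
rewrite tens_addE !tlift_pi big_cat /= scaler_sumr big_map; congr (_ + _).
by apply: eq_bigr => p _ /=; rewrite bilinZl.
Qed.

End Lift.

Lemma tlift_comb (Q : lmodType k) c (f g : M -> N -> Q) q :
  tlift (fun x y => c *: f x y + g x y) q = c *: tlift f q + tlift g q.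
Proof. by rewrite /tlift big_split /= scaler_sumr. Qed.

Lemma eq_tlift (Q : lmodType k) (f g : M -> N -> Q) q :
  (forall x y, f x y = g x y) -> tlift f q = tlift g q.
Proof. by move=> e; apply: eq_bigr => p _. Qed.

End Tensor.

Section DirectSum.
Variables (k : comPzRingType) (V : nat -> lmodType k).

Record dsum := DSum {
  dsval :> forall n, V n;
  dsum_fin : exists N, forall n, (N <= n)%N -> dsval n = 0
}.
HB.instance Definition _ := gen_eqMixin dsum.
HB.instance Definition _ := gen_choiceMixin dsum.

Lemma dsumP (z w : dsum) : (forall n, z n = w n) -> z = w.
Proof.
case: z w => [z hz] [w hw] /= e.
have {}e : z = w by apply: functional_extensionality_dep.
by subst w; congr DSum; apply: Prop_irrelevance.
Qed.

Lemma dsum_fin0 : exists N, forall n, (N <= n)%N -> (0 : V n) = 0.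
Proof. by exists 0%N. Qed.
Lemma dsum_finD (z w : dsum) :
  exists N, forall n, (N <= n)%N -> z n + w n = 0.
Proof.
case: (dsum_fin z) (dsum_fin w) => [N hN] [N' hN']; exists (maxn N N') => n.
by rewrite geq_max => /andP[h h']; rewrite hN // hN' // addr0.
Qed.
Lemma dsum_finN (z : dsum) : exists N, forall n, (N <= n)%N -> - z n = 0.
Proof.
by case: (dsum_fin z) => [N hN]; exists N => n h; rewrite hN // oppr0.
Qed.
Lemma dsum_finZ c (z : dsum) :
  exists N, forall n, (N <= n)%N -> c *: z n = 0.
Proof.
by case: (dsum_fin z) => [N hN]; exists N => n h; rewrite hN // scaler0.
Qed.

Definition dsum0 := DSum dsum_fin0.
Definition dsum_add z w := DSum (dsum_finD z w).
Definition dsum_opp z := DSum (dsum_finN z).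
Definition dsum_scale c z := DSum (dsum_finZ c z).

Lemma dsum_addA : associative dsum_add.
Proof. by move=> z w u; apply: dsumP => n /=; rewrite addrA. Qed.
Lemma dsum_addC : commutative dsum_add.
Proof. by move=> z w; apply: dsumP => n /=; rewrite addrC. Qed.
Lemma dsum_add0 : left_id dsum0 dsum_add.
Proof. by move=> z; apply: dsumP => n /=; rewrite add0r. Qed.
Lemma dsum_addN : left_inverse dsum0 dsum_opp dsum_add.
Proof. by move=> z; apply: dsumP => n /=; rewrite addNr. Qed.
HB.instance Definition _ :=
  GRing.isZmodule.Build dsum dsum_addA dsum_addC dsum_add0 dsum_addN.

Lemma dsum_scaleA a b z : dsum_scale a (dsum_scale b z) = dsum_scale (a * b) z.
Proof. by apply: dsumP => n /=; rewrite scalerA. Qed.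
Lemma dsum_scale1 z : dsum_scale 1 z = z.
Proof. by apply: dsumP => n /=; rewrite scale1r. Qed.
Lemma dsum_scaleDr a z w :
  dsum_scale a (z + w) = dsum_scale a z + dsum_scale a w.
Proof. by apply: dsumP => n /=; rewrite scalerDr. Qed.
Lemma dsum_scaleDl z a b :
  dsum_scale (a + b) z = dsum_scale a z + dsum_scale b z.
Proof. by apply: dsumP => n /=; rewrite scalerDl. Qed.
HB.instance Definition _ := GRing.Zmodule_isLmodule.Build k dsum
  dsum_scaleA dsum_scale1 dsum_scaleDr (fun z a b => dsum_scaleDl z a b).

Definition dsum_in_val m (x : V m) n : V n :=
  if m =P n is ReflectT e then ecast i (V i) e x else 0.
Lemma dsum_in_fin m (x : V m) :
  exists N, forall n, (N <= n)%N -> dsum_in_val x n = 0.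
Proof.
exists m.+1 => n; rewrite /dsum_in_val; case: eqP => // e.
by rewrite {1}e ltnn.
Qed.
Definition dsum_in m (x : V m) : dsum := DSum (dsum_in_fin x).
Arguments dsval : simpl never.

Lemma dsum_in_same m (x : V m) : dsum_in x m = x.
Proof.
by rewrite /dsval /= /dsum_in_val; case: eqP => // e; rewrite (eq_axiomK e).
Qed.
Lemma dsum_in_neq m (x : V m) n : m != n -> dsum_in x n = 0.
Proof. by rewrite /dsval /= /dsum_in_val; case: eqP. Qed.

Lemma dsum_in_linear m : linear (@dsum_in m).
Proof.
move=> c x y; apply: dsumP => n; rewrite -[RHS]/(c *: dsum_in x n + dsum_in y n).
have [e|ne] := eqVneq m n; last by rewrite !dsum_in_neq // scaler0 addr0.
by case: _ / e; rewrite !dsum_in_same.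
Qed.
HB.instance Definition _ m :=
  GRing.isLinear.Build k (V m) dsum _ (@dsum_in m) (@dsum_in_linear m).

Lemma dsvalD (z w : dsum) n : (z + w) n = z n + w n. Proof. by []. Qed.
Lemma dsvalZ c (z : dsum) n : (c *: z) n = c *: z n. Proof. by []. Qed.
Lemma dsval_sum I (r : seq I) (F : I -> dsum) n :
  (\sum_(i <- r) F i) n = \sum_(i <- r) F i n.
Proof. exact: (big_morph (fun z : dsum => z n) (fun=> fun=> erefl)). Qed.

Lemma dsum_decomp N (z : dsum) : (forall n, (N <= n)%N -> z n = 0) ->
  z = \sum_(i < N) dsum_in (z i).
Proof.
move=> hz; apply: dsumP => n; rewrite dsval_sum.
have [lt_nN|le_Nn] := ltnP n N.
  rewrite (bigD1 (Ordinal lt_nN)) //= dsum_in_same big1 ?addr0 // => i ne.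
  by rewrite dsum_in_neq.
by rewrite hz // big1 // => i _; rewrite dsum_in_neq // neq_ltn
  (leq_trans (ltn_ord i) le_Nn).
Qed.

Definition dsum_deg (z : dsum) : nat := sval (cid (dsum_fin z)).
Lemma dsum_degP z n : (dsum_deg z <= n)%N -> z n = 0.
Proof. exact: (svalP (cid (dsum_fin z))). Qed.

Lemma dsum_ind (P : dsum -> Prop) : P 0 ->
  (forall z w, P z -> P w -> P (z + w)) -> (forall n x, P (@dsum_in n x)) ->
  forall z, P z.
Proof.
by move=> P0 PD Pi z; rewrite (dsum_decomp (@dsum_degP z)); elim/big_ind: _.
Qed.

(* The map induced by the family phi; meaningful when all phi n are linear. *)
Definition dsum_lift (Q : lmodType k) (phi : forall n, V n -> Q) (z : dsum) : Q :=
  \sum_(n < dsum_deg z) phi n (z n).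

Section Lift.
Variables (Q : lmodType k) (phi : forall n, V n -> Q).

Section Linear.
Hypothesis hphi : forall n, linear (@phi n).

Lemma dsum_lift0 n : @phi n 0 = 0.
Proof.
have := @hphi n 1 0 0; rewrite scaler0 addr0 scale1r => e.
by apply: (addIr (@phi n 0)); rewrite -e add0r.
Qed.

Lemma dsum_liftN N (z : dsum) : (forall n, (N <= n)%N -> z n = 0) ->
  dsum_lift (@phi) z = \sum_(n < N) @phi n (z n).
Proof.
have aux M M' : (forall n, (M <= n)%N -> z n = 0) ->
    \sum_(n < M) @phi n (z n) = \sum_(n < maxn M M') @phi n (z n).
  move=> h; rewrite -(subnKC (leq_maxl M M')) big_split_ord /=.
  rewrite [X in _ = _ + X]big1 ?addr0 // => i _.
  by rewrite h ?dsum_lift0 ?leq_addr.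
move=> h; rewrite /dsum_lift (aux _ N (@dsum_degP z)).
by rewrite (aux _ (dsum_deg z) h) maxnC.
Qed.

Lemma dsum_lift_linear : linear (dsum_lift (@phi)).
Proof.
move=> c z w; set N := maxn (dsum_deg z) (dsum_deg w).
have hz n : (N <= n)%N -> z n = 0.
  by rewrite geq_max => /andP[h _]; apply: dsum_degP.
have hw n : (N <= n)%N -> w n = 0.
  by rewrite geq_max => /andP[_ h]; apply: dsum_degP.
rewrite (@dsum_liftN N); last first.
  by move=> n h; rewrite dsvalD dsvalZ hz // hw // scaler0 addr0.
rewrite (dsum_liftN hz) (dsum_liftN hw) scaler_sumr -big_split /=.
by apply: eq_bigr => i _; rewrite hphi.
Qed.

Lemma dsum_lift_in n x : dsum_lift (@phi) (@dsum_in n x) = @phi n x.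
Proof.
rewrite (@dsum_liftN n.+1); last by move=> m h; rewrite dsum_in_neq // ltn_eqF.
rewrite big_ord_recr /= dsum_in_same big1 ?add0r // => i _.
by rewrite dsum_in_neq ?dsum_lift0 // gtn_eqF.
Qed.
End Linear.

Lemma dsum_lift_comb c (psi : forall n, V n -> Q) z :
  dsum_lift (fun n x => c *: @phi n x + psi n x) z =
  c *: dsum_lift (@phi) z + dsum_lift psi z.
Proof. by rewrite /dsum_lift big_split /= scaler_sumr. Qed.

Lemma eq_dsum_lift (psi : forall n, V n -> Q) z :
  (forall n x, @phi n x = psi n x) -> dsum_lift (@phi) z = dsum_lift psi z.
Proof. by move=> e; apply: eq_bigr. Qed.
End Lift.

End DirectSum.

Section Sha.
Variables (k : comPzRingType) (A : comPzAlgType k).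

(* tpow n is the (n + 1)-st tensor power of A, spanned by the pure tensors *)
(* x_0 (x) ... (x) x_n.                                                    *)
Fixpoint tpow (n : nat) : lmodType k :=
  if n is n'.+1 then tens A (tpow n') else A.

(* The phantom lam selects the product: sha_mul depends on the weight. *)
Definition Sha (lam : k) : Type := dsum tpow.

Variable lam : k.
Local Notation sha := (Sha lam).
HB.instance Definition _ := GRing.Lmodule.on sha.

(* The linear map sending x_0 (x) ... (x) x_n to a (x) x_0 (x) ... (x) x_n. *)
Definition sha_cons_val (a : A) (z : sha) (n : nat) : tpow n :=
  if n is n'.+1 then tpure a (z n') else 0.
Lemma sha_cons_fin a z :
  exists N, forall n, (N <= n)%N -> sha_cons_val a z n = 0.
Proof.
case: (dsum_fin z) => N hN; exists N.+1 => -[//|n]; rewrite ltnS => h.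
by rewrite /= hN // (bilin0r (tpure_bilin _ _)).
Qed.
Definition sha_cons (a : A) (z : sha) : sha := DSum (sha_cons_fin a z).

(* Multiplication of the first tensor factor by a. *)
Definition tpow_act (a : A) (n : nat) : tpow n -> tpow n :=
  if n is n'.+1 return tpow n -> tpow n
  then tlift (fun (b : A) (y : tpow n') => tpure (a * b) y) else fun x => a * x.

(* The product of homogeneous elements: with x = a_0 (x) x' of degree m and *)
(* y = b_0 (x) y' of degree n, each clause is the inductive formula for the *)
(* mixable shuffle product, extended bilinearly by tlift.                   *)
Fixpoint tpow_mul (m : nat) : forall n, tpow m -> tpow n -> sha :=
  match m return forall n, tpow m -> tpow n -> sha with
  | 0 => fun n x y => dsum_in (tpow_act x y)
  | m'.+1 =>
    fix tpow_mulS (n : nat) : tpow m'.+1 -> tpow n -> sha :=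
      match n return tpow m'.+1 -> tpow n -> sha with
      | 0 => fun x y => dsum_in (tpow_act y x)
      | n'.+1 => fun x y =>
        tlift (fun (a0 : A) (x' : tpow m') =>
        tlift (fun (b0 : A) (y' : tpow n') =>
          sha_cons (a0 * b0)
            (@tpow_mul m' n'.+1 x' (tpure (1 : A) y')
             + tpow_mulS n' (tpure (1 : A) x') y' + lam *: @tpow_mul m' n' x' y')) y) x
      end
  end.

Definition sha_mul (z w : sha) : sha :=
  dsum_lift (fun m x => dsum_lift (fun n y => @tpow_mul m n x y) w) z.

Definition sha_inj (a : A) : sha := @dsum_in k tpow 0 a.

Lemma sha_cons_bilin : bilin sha_cons.
Proof.
split=> [z c a b|a c z w]; apply: dsumP => -[|n].
- by rewrite /dsval /= scaler0 addr0.
- exact: ((tpure_bilin _ _).1 (z n)).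
- by rewrite /dsval /= scaler0 addr0.
- exact: ((tpure_bilin _ _).2 a).
Qed.

Lemma sha_cons_in a n x :
  sha_cons a (@dsum_in k tpow n x) = @dsum_in k tpow n.+1 (tpure a x).
Proof.
apply: dsumP => -[|m].
  by rewrite dsum_in_neq.
rewrite -[LHS]/(tpure a (@dsum_in k tpow n x m)).
have [e|ne] := eqVneq n m.
  by case: _ / e; rewrite !dsum_in_same.
by rewrite !dsum_in_neq // (bilin0r (tpure_bilin _ _)).
Qed.

Lemma tpow_act_bilin n : bilin (fun a (x : tpow n) => tpow_act a x).
Proof.
case: n => [|n]; split=> [y c a b|a c x y] /=.
- by rewrite mulrDl pzscalerAl.
- by rewrite mulrDr pzscalerAr.
- rewrite -tlift_comb; apply: eq_tlift => {}x z.
  by rewrite mulrDl -pzscalerAl (tpure_bilin _ _).1.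
- apply: tlift_linear; split=> [z d u v|u d z v].
    by rewrite mulrDr -pzscalerAr (tpure_bilin _ _).1.
  by rewrite (tpure_bilin _ _).2.
Qed.

Lemma scaler_comb3 (M : lmodType k) (c l : k) (x y z x' y' z' : M) :
  c *: x + x' + (c *: y + y') + l *: (c *: z + z') =
  c *: (x + y + l *: z) + (x' + y' + l *: z').
Proof.
by rewrite !scalerDr !scalerA (mulrC l) (addrACA (c *: x)) [LHS]addrACA.
Qed.

Lemma tpow_mul_bilin m n : bilin (@tpow_mul m n).
Proof.
elim: m n => [|m IHm] n.
  split=> [y c x x'|x c y y'] /=.
    by rewrite (tpow_act_bilin n).1 linearP.
  by rewrite (tpow_act_bilin n).2 linearP.
elim: n => [|n IHn].
  split=> [y c x x'|x c y y'] /=.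
    by rewrite -linearP -(tpow_act_bilin m.+1).2.
  by rewrite -linearP -(tpow_act_bilin m.+1).1.
pose g a0 x' b0 y' := sha_cons (a0 * b0)
   (@tpow_mul m n.+1 x' (tpure (1 : A) y') + @tpow_mul m.+1 n (tpure (1 : A) x') y'
    + lam *: @tpow_mul m n x' y').
have hg1 x' y' : bilin (fun a0 b0 => g a0 x' b0 y').
  by split=> [b c a a'|a c b b']; rewrite /g ?mulrDl ?mulrDr -?pzscalerAl
    -?pzscalerAr sha_cons_bilin.1.
have hg2 a0 b0 : bilin (fun x' y' => g a0 x' b0 y').
  split=> [y c x x'|x c y y']; rewrite /g -(sha_cons_bilin.2); congr sha_cons.
    rewrite (IHm n.+1).1 (tpure_bilin _ _).2 IHn.1 (IHm n).1.
    exact: scaler_comb3.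
  rewrite (tpure_bilin _ _).2 (IHm n.+1).2 IHn.2 (IHm n).2.
  exact: scaler_comb3.
have E x y : @tpow_mul m.+1 n.+1 x y = tlift (fun a0 x' => tlift (g a0 x') y) x.
  by [].
have hin a0 x' : bilin (g a0 x').
  split=> [y c b b'|b c y y'].
    by have := (hg1 x' y).2 a0 c b b'.
  by have := (hg2 a0 b).2 x' c y y'.
split=> [y c x x'|x c y y']; rewrite !E.
  apply: tlift_linear; split=> [z d a a'|a d z z'].
    rewrite -tlift_comb; apply: eq_tlift => b y'; exact: (hg1 z y').1.
  rewrite -tlift_comb; apply: eq_tlift => b y'; exact: (hg2 a b).1.
by rewrite -tlift_comb; apply: eq_tlift => a z; apply: tlift_linear.
Qed.

Lemma sha_mul_bilin : bilin sha_mul.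
Proof.
split=> [w c z z'|z c w w'].
  apply: dsum_lift_linear => m d x x'; rewrite -dsum_lift_comb.
  by apply: eq_dsum_lift => n y; apply: (tpow_mul_bilin m n).1.
rewrite /sha_mul -dsum_lift_comb; apply: eq_dsum_lift => m x.
by apply: dsum_lift_linear => n; apply: (tpow_mul_bilin m n).2.
Qed.

Lemma sha_mul_in m n x y :
  sha_mul (@dsum_in k tpow m x) (@dsum_in k tpow n y) = tpow_mul x y.
Proof.
rewrite /sha_mul dsum_lift_in.
  by rewrite dsum_lift_in // => p; apply: (tpow_mul_bilin m p).2.
move=> p c u v; rewrite -dsum_lift_comb.
by apply: eq_dsum_lift => q w; apply: (tpow_mul_bilin p q).1.
Qed.

Lemma sha_linear_ext (Q : lmodType k) (f g : sha -> Q) :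
  linear f -> linear g ->
  (forall n x, f (@dsum_in k tpow n x) = g (@dsum_in k tpow n x)) -> f =1 g.
Proof.
move=> hf hg e.
have add0 (h : sha -> Q) : linear h -> h 0 = 0.
  move=> hh; have := hh 1 0 0; rewrite scaler0 addr0 scale1r => e0.
  by apply: (addIr (h 0)); rewrite -e0 add0r.
have addD (h : sha -> Q) z w : linear h -> h (z + w) = h z + h w.
  by move=> hh; have := hh 1 z w; rewrite !scale1r.
apply: dsum_ind => [|z w ez ew|//]; first by rewrite !add0.
by rewrite !addD // ez ew.
Qed.

Lemma sha_mul_inj a b : sha_mul (sha_inj a) (sha_inj b) = sha_inj (a * b).
Proof. exact: sha_mul_in. Qed.

Lemma sha_mul_inj_cons a b z :
  sha_mul (sha_inj a) (sha_cons b z) = sha_cons (a * b) z.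
Proof.
move: z; apply: sha_linear_ext => [c z w|c z w|n x].
- by rewrite sha_cons_bilin.2 sha_mul_bilin.2.
- exact: sha_cons_bilin.2.
rewrite !sha_cons_in sha_mul_in /= tliftE //.
split=> [y c u v|u c y v].
  by rewrite mulrDr -pzscalerAr (tpure_bilin _ _).1.
by rewrite (tpure_bilin _ _).2.
Qed.

Lemma sha_mul_cons_inj a b z :
  sha_mul (sha_cons b z) (sha_inj a) = sha_cons (a * b) z.
Proof.
move: z; apply: sha_linear_ext => [c z w|c z w|n x].
- by rewrite sha_cons_bilin.2 sha_mul_bilin.1.
- exact: sha_cons_bilin.2.
rewrite !sha_cons_in sha_mul_in /= tliftE //.
split=> [y c u v|u c y v].
  by rewrite mulrDr -pzscalerAr (tpure_bilin _ _).1.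
by rewrite (tpure_bilin _ _).2.
Qed.

Lemma sha_mul_cons a b z w :
  sha_mul (sha_cons a z) (sha_cons b w) =
  sha_cons (a * b)
    (sha_mul z (sha_cons 1 w) + sha_mul (sha_cons 1 z) w
     + lam *: sha_mul z w).
Proof.
have lin3 (f1 f2 f3 : sha -> sha) : linear f1 -> linear f2 -> linear f3 ->
    linear (fun z => sha_cons (a * b) (f1 z + f2 z + lam *: f3 z)).
  move=> h1 h2 h3 c u v; rewrite h1 h2 h3 -(sha_cons_bilin.2).
  congr sha_cons.
  exact: scaler_comb3.
move: z; apply: sha_linear_ext => [c u v||m x].
- by rewrite sha_cons_bilin.2 sha_mul_bilin.1.
- apply: lin3 => c u v; first exact: sha_mul_bilin.1.
    by rewrite sha_cons_bilin.2 sha_mul_bilin.1.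
  exact: sha_mul_bilin.1.
move: w; apply: sha_linear_ext => [c u v||n y].
- by rewrite sha_cons_bilin.2 sha_mul_bilin.2.
- apply: lin3 => c u v; last 2 first.
  + exact: sha_mul_bilin.2.
  + exact: sha_mul_bilin.2.
  by rewrite sha_cons_bilin.2 sha_mul_bilin.2.
rewrite !sha_cons_in !sha_mul_in.
pose g a0 x' b0 y' := sha_cons (a0 * b0)
   (@tpow_mul m n.+1 x' (tpure (1 : A) y') + @tpow_mul m.+1 n (tpure (1 : A) x') y'
    + lam *: @tpow_mul m n x' y').
have hg1 x' y' : bilin (fun a0 b0 => g a0 x' b0 y').
  by split=> [b' c u u'|u c b' b'']; rewrite /g ?mulrDl ?mulrDr -?pzscalerAl
    -?pzscalerAr sha_cons_bilin.1.
have hg2 a0 b0 : bilin (fun x' y' => g a0 x' b0 y').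
  split=> [y1 c x1 x'|x1 c y1 y']; rewrite /g -(sha_cons_bilin.2);
      congr sha_cons.
    rewrite (tpow_mul_bilin m n.+1).1 (tpure_bilin _ _).2.
    rewrite (tpow_mul_bilin m.+1 n).1 (tpow_mul_bilin m n).1.
    exact: scaler_comb3.
  rewrite (tpure_bilin _ _).2 (tpow_mul_bilin m n.+1).2.
  rewrite (tpow_mul_bilin m.+1 n).2 (tpow_mul_bilin m n).2.
  exact: scaler_comb3.
have hin a0 x' : bilin (g a0 x').
  split=> [y' c b' b''|b' c y' y''].
    by have := (hg1 x' y').2 a0 c b' b''.
  by have := (hg2 a0 b').2 x' c y' y''.
rewrite -[LHS]/(tlift (fun a0 x' => tlift (g a0 x') (tpure b y)) (tpure a x)).
rewrite tliftE ?tliftE //.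
split=> [z d u u'|u d z z'].
  by rewrite -tlift_comb; apply: eq_tlift => b' y'; exact: (hg1 z y').1.
by rewrite -tlift_comb; apply: eq_tlift => b' y'; exact: (hg2 u b').1.
Qed.

Inductive pure_tens : nat -> sha -> Prop :=
| pure_tens_inj a : pure_tens 0 (sha_inj a)
| pure_tens_cons a n z : pure_tens n z -> pure_tens n.+1 (sha_cons a z).

Lemma sha_ind (P : sha -> Prop) : P 0 ->
  (forall z w, P z -> P w -> P (z + w)) -> (forall n z, pure_tens n z -> P z) ->
  forall z, P z.
Proof.
move=> P0 PD Pp; apply: dsum_ind => // n x.
have [s hs ->] : exists2 s : seq sha, (forall i, (i < size s)%N ->
    pure_tens n (nth 0 s i)) & @dsum_in k tpow n x = \sum_(z <- s) z.
  elim: n x => [|n IH] x.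
    exists [:: sha_inj x]; last by rewrite big_seq1.
    by case=> // _; apply: pure_tens_inj.
  move: x; apply: tens_ind => [|x y [s hs es] [t ht et]|a y].
  - by exists [::] => //; rewrite big_nil linear0.
  - exists (s ++ t); last first.
      by rewrite big_cat /= -es -et; apply: (linearD (@dsum_in k tpow n.+1)).
    move=> i; rewrite nth_cat size_cat; case: (ltnP i (size s)) => [h _|h h'].
      exact: hs.
    by apply: ht; rewrite ltn_subLR.
  - case: (IH y) => s hs es; exists [seq sha_cons a z | z <- s].
      move=> i; rewrite size_map => h; rewrite (nth_map 0) //.
      by apply: pure_tens_cons; apply: hs.
    rewrite -sha_cons_in es big_map.
    elim: (s) => [|z t IHt]; first by rewrite !big_nil (bilin0r sha_cons_bilin).
    by rewrite !big_cons (bilinDr sha_cons_bilin) IHt.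
elim: s hs => [|z s IH] hs; first by rewrite big_nil.
rewrite big_cons; apply: PD; first exact: Pp (hs 0%N isT).
by apply: IH => i h; apply: (hs i.+1).
Qed.

Lemma pure_tensP n z : pure_tens n z -> (exists a, z = sha_inj a) \/
  (exists a m w, [/\ n = m.+1, pure_tens m w & z = sha_cons a w]).
Proof.
by case=> [a|a m w hw]; [left; exists a|right; exists a, m, w].
Qed.

Lemma sha_mulC : commutative sha_mul.
Proof.
have pureC N m n z w : (m + n <= N)%N -> pure_tens m z -> pure_tens n w ->
    sha_mul z w = sha_mul w z.
  elim: N m n z w => [|N IH] m n z w hN hz hw;
    case: (pure_tensP hz) hN => [[a ->]|[a [m' [z' [-> hz' ->]]]]] hN;
    case: (pure_tensP hw) hN => [[b ->]|[b [n' [w' [-> hw' ->]]]]] hN //;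
    rewrite ?sha_mul_inj_cons ?sha_mul_cons_inj ?sha_mul_inj 1?mulrC //.
  rewrite !sha_mul_cons mulrC; congr sha_cons.
  rewrite addSn addnS ltnS in hN.
  have hN0 : (m' + n' <= N)%N by apply: ltnW.
  have hN1 : (m' + n'.+1 <= N)%N by rewrite addnS.
  rewrite [X in X + _]addrC (IH _ _ _ _ hN0 hz' hw').
  rewrite (IH _ _ _ _ hN1 hz' (pure_tens_cons 1 hw')).
  by rewrite (IH m'.+1 n' _ _ hN (pure_tens_cons 1 hz') hw').
move=> z w; move: z; apply: sha_ind.
- by rewrite (bilin0l sha_mul_bilin) (bilin0r sha_mul_bilin).
- by move=> u v eu ev; rewrite (bilinDl sha_mul_bilin) eu ev
    (bilinDr sha_mul_bilin).
move=> m z hz; move: w; apply: sha_ind.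
- by rewrite (bilin0l sha_mul_bilin) (bilin0r sha_mul_bilin).
- by move=> u v eu ev; rewrite (bilinDr sha_mul_bilin) eu ev
    (bilinDl sha_mul_bilin).
by move=> n w hw; apply: pureC hz hw.
Qed.

Lemma sha_mul1 : left_id (sha_inj 1) sha_mul.
Proof.
apply: sha_ind => [|z w ez ew|n z /pure_tensP[[a ->]|[a [m [w [_ _ ->]]]]]].
- by rewrite (bilin0r sha_mul_bilin).
- by rewrite (bilinDr sha_mul_bilin) ez ew.
- by rewrite sha_mul_inj mul1r.
- by rewrite sha_mul_inj_cons mul1r.
Qed.

Lemma sha_mul_act a z w :
  sha_mul (sha_mul (sha_inj a) z) w = sha_mul (sha_inj a) (sha_mul z w).
Proof.
move: z; apply: sha_ind => [|u v eu ev|m z hz].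
- by rewrite !(bilin0r sha_mul_bilin, bilin0l sha_mul_bilin).
- by rewrite !(bilinDr sha_mul_bilin, bilinDl sha_mul_bilin) eu ev.
move: w; apply: sha_ind => [|u v eu ev|n w hw].
- by rewrite !(bilin0r sha_mul_bilin).
- by rewrite !(bilinDr sha_mul_bilin) eu ev.
case: (pure_tensP hz) => [[b ->]|[b [m' [z' [_ _ ->]]]]];
case: (pure_tensP hw) => [[c ->]|[c [n' [w' [_ _ ->]]]]];
  rewrite ?(sha_mul_inj, sha_mul_inj_cons, sha_mul_cons_inj, sha_mul_cons)
    ?(sha_mul_inj, sha_mul_inj_cons) ?mulrA //.
by rewrite (mulrC a c).
Qed.

Lemma sha_mul_actr a z w :
  sha_mul z (sha_mul (sha_inj a) w) = sha_mul (sha_inj a) (sha_mul z w).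
Proof. by rewrite sha_mulC sha_mul_act (sha_mulC w). Qed.

Lemma sha_consE a z : sha_cons a z = sha_mul (sha_inj a) (sha_cons 1 z).
Proof. by rewrite sha_mul_inj_cons mulr1. Qed.

Lemma sha_mulA : associative sha_mul.
Proof.
pose P := sha_cons 1.
have PD z w : P (z + w) = P z + P w := bilinDr sha_cons_bilin 1 z w.
have PZ c z : P (c *: z) = c *: P z := bilinZr sha_cons_bilin c 1 z.
have PM z w : sha_mul (P z) (P w) =
    P (sha_mul z (P w) + sha_mul (P z) w + lam *: sha_mul z w).
  by rewrite /P sha_mul_cons mulr1.
have mulDl := bilinDl sha_mul_bilin; have mulDr := bilinDr sha_mul_bilin.
have mulZl := bilinZl sha_mul_bilin; have mulZr := bilinZr sha_mul_bilin.
have pureA N m n p z w u : (m + n + p <= N)%N ->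
    pure_tens m z -> pure_tens n w -> pure_tens p u ->
    sha_mul z (sha_mul w u) = sha_mul (sha_mul z w) u.
  elim: N m n p z w u => [|N IH] m n p z w u hN hz hw hu;
    case: (pure_tensP hz) hN => [[a ->]|[a [m' [z' [-> hz' ->]]]]] hN //;
    rewrite ?sha_mul_act //.
  case: (pure_tensP hw) hN => [[b ->]|[b [n' [w' [-> hw' ->]]]]] hN.
    by rewrite sha_mul_actr (sha_mulC _ (sha_inj b)) sha_mul_act.
  case: (pure_tensP hu) hN => [[c ->]|[c [p' [u' [-> hu' ->]]]]] hN.
    by rewrite !(sha_mulC _ (sha_inj c)) sha_mul_actr.
  rewrite (sha_consE a) (sha_consE b) (sha_consE c) -/P.
  have -> : sha_mul (sha_mul (sha_inj b) (P w')) (sha_mul (sha_inj c) (P u')) =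
      sha_mul (sha_inj b) (sha_mul (sha_inj c) (sha_mul (P w') (P u'))).
    by rewrite sha_mul_act sha_mul_actr.
  have -> : sha_mul (sha_mul (sha_inj a) (P z')) (sha_mul (sha_inj b) (P w')) =
      sha_mul (sha_inj a) (sha_mul (sha_inj b) (sha_mul (P z') (P w'))).
    by rewrite sha_mul_act sha_mul_actr.
  rewrite !sha_mul_act; congr sha_mul.
  rewrite sha_mul_actr; congr sha_mul.
  rewrite !sha_mul_actr; congr sha_mul.
  have hz1 := pure_tens_cons 1 hz'; have hw1 := pure_tens_cons 1 hw'.
  have hu1 := pure_tens_cons 1 hu'; rewrite -/P in hz1 hw1 hu1.
  have IHe d e f x y v : pure_tens d x -> pure_tens e y -> pure_tens f v ->
      (d + e + f < m'.+1 + n'.+1 + p'.+1)%N ->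
      sha_mul x (sha_mul y v) = sha_mul (sha_mul x y) v.
    move=> hx hy hv h; apply: (IH d e f) => //.
    by rewrite -ltnS; apply: leq_trans hN.
  rewrite (PM w' u') (PM z' w') !PM -(PM z' w') -(PM w' u').
  congr P; rewrite !mulDl !mulDr !mulZl !mulZr.
  rewrite (IHe _ _ _ _ _ _ hz' hw1 hu1) ?(IHe _ _ _ _ _ _ hz1 hw' hu1);
    rewrite ?(IHe _ _ _ _ _ _ hz' hw' hu1) ?(IHe _ _ _ _ _ _ hz1 hw1 hu');
    rewrite ?(IHe _ _ _ _ _ _ hz' hw1 hu') ?(IHe _ _ _ _ _ _ hz1 hw' hu');
    rewrite ?(IHe _ _ _ _ _ _ hz' hw' hu') ?(addSn, addnS) //;
    last by rewrite ltnS -addn2 leq_addr.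
  by rewrite !scalerDr [LHS](AC (1*3*3)%AC ((1*2*5)*3*(6*4*7))%AC).
move=> z w u; move: z; apply: sha_ind => [|x y ex ey|m z hz].
- by rewrite !(bilin0l sha_mul_bilin).
- by rewrite !mulDl ex ey.
move: w; apply: sha_ind => [|x y ex ey|n w hw].
- by rewrite !(bilin0r sha_mul_bilin, bilin0l sha_mul_bilin).
- by rewrite !(mulDl, mulDr) ex ey.
move: u; apply: sha_ind => [|x y ex ey|p u hu].
- by rewrite !(bilin0r sha_mul_bilin).
- by rewrite !mulDr ex ey.
exact: pureA hz hw hu.
Qed.

HB.instance Definition _ :=
  GRing.Zmodule_isComPzRing.Build sha sha_mulA sha_mulC sha_mul1
   (bilinDl sha_mul_bilin).
HB.instance Definition _ := isPzAlgebra.Build k sha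
  (@scalerA k sha) (@scale1r k sha) (@scalerDr k sha) (@scalerDl k sha)
  (fun a z w => esym (bilinZl sha_mul_bilin a z w)).

Lemma sha_inj_zmod_morphism : zmod_morphism sha_inj.
Proof. exact: (linearB (@dsum_in k tpow 0)). Qed.
HB.instance Definition _ :=
  GRing.isZmodMorphism.Build A sha sha_inj sha_inj_zmod_morphism.
Lemma sha_inj_monoid_morphism : monoid_morphism sha_inj.
Proof. by split=> // a b; rewrite -sha_mul_inj. Qed.
HB.instance Definition _ :=
  GRing.isMonoidMorphism.Build A sha sha_inj sha_inj_monoid_morphism.
Lemma sha_inj_scalable : scalable sha_inj.
Proof. by move=> c a; apply: (linearZZ (@dsum_in k tpow 0)). Qed.

Definition sha_op : sha -> sha := sha_cons 1.
HB.instance Definition _ :=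
  GRing.isLinear.Build k sha sha _ sha_op (sha_cons_bilin.2 1).

End Sha.

Definition is_unit (A : comPzRingType) (x : A) : Prop := exists y, x * y = 1.

Definition is_rb_localization (k : comPzRingType) (lam : k)
    (R : comPzAlgType k) (P : {linear R -> R}) (S : mulrClosed R)
    (L : comPzAlgType k) (PL : {linear L -> L})
    (i : {rmorphism R -> L}) : Prop :=
  [/\ rota_baxter lam PL,
      rb_morphism P PL i,
      (forall s, s \in S -> is_unit (i s)) &
      forall (R' : comPzAlgType k) (P' : {linear R' -> R'})
        (f : {rmorphism R -> R'}),
        rota_baxter lam P' -> rb_morphism P P' f ->
        (forall s, s \in S -> is_unit (f s)) ->
        exists2 fS : {rmorphism L -> R'},
          rb_morphism PL P' fS /\ (forall x, fS (i x) = f x) &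
          forall g : {rmorphism L -> R'},
            rb_morphism PL P' g -> (forall x, g (i x) = f x) -> g =1 fS].

Section ShaLocalization.
Variables (k : comPzRingType) (lam : k) (R : comPzAlgType k).
Variables (P : {linear R -> R}) (S : mulrClosed R).

Definition sha_loc_relators : set (Sha (loc S) lam) :=
  [set z | exists a : R, z =
     sha_inj lam (loc_inj S (P a)) -
     dsum_in (V := tpow (loc S)) (m := 1) (tpure (1 : loc S) (loc_inj S a))].

Definition sha_loc_ideal : rb_ideal (@sha_op k (loc S) lam) :=
  rb_gen (@sha_op k (loc S) lam) sha_loc_relators.

Definition sha_loc : comPzAlgType k := rb_quot sha_loc_ideal.

Definition sha_loc_op : {linear sha_loc -> sha_loc} :=
  @rb_quot_op _ _ _ sha_loc_ideal.

Definition sha_loc_inj : {rmorphism R -> sha_loc} :=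
  rb_pi sha_loc_ideal \o (@sha_inj k (loc S) lam \o loc_inj S).

End ShaLocalization.

(* Main.v *)
Require Import Defs.
From HB Require Import structures.
From mathcomp Require Import all_boot all_algebra ring.
From mathcomp Require Import boolp classical_sets.
Set Implicit Arguments.
Unset Strict Implicit.
Unset Printing Implicit Defensive.
Import GRing.Theory.
Local Open Scope ring_scope.

(** The relators are what it takes for i to commute with the operators, and S is
inverted already in S^-1 R.  The quotient has the universal property because
each of the three steps of its construction has its own.  A Rota-Baxter
morphism f out of R that inverts S extends uniquely to an algebra morphism phi
out of S^-1 R ([loc_universal]); phi extends uniquely to a Rota-Baxter morphism
F out of Sha(S^-1 R) ([sha_universal]); and F factors through the quotient by a
generated Rota-Baxter ideal as soon as it kills the generators, because its
kernel is a Rota-Baxter ideal ([rb_gen_ker], [rb_quot_universal]).  It does kill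
P a - 1 (x) a, which it maps to f (P a) - P' (f a).

The only step with content is the freeness of Sha.  Any Rota-Baxter
morphism F that extends phi must satisfy
  F (a (x) z) = phi a * P' (F z),
because a (x) z is the product of a and 1 (x) z; this determines F by recursion on
the tensor degree, and conversely it defines a linear map by the universal
properties of tensor products and direct sums.  That map is multiplicative
because the recursive formula for the mixable shuffle product of a (x) z and
b (x) w becomes, under F, the Rota-Baxter identity of P' at F z and F w. *)

(** Packs a function as a morphism inside a proof, where the function depends
on local hypotheses. *)
Lemma rmorphism_of (A B : comPzRingType) (f : A -> B) :
  zmod_morphism f -> monoid_morphism f -> exists g : {rmorphism A -> B}, g =1 f.
Proof.
move=> hD hM.
pose mD := GRing.isZmodMorphism.Build A B f hD.
pose mM := GRing.isMonoidMorphism.Build A B f hM.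
by exists (HB.pack_for {rmorphism A -> B} f mD mM).
Qed.

(** * Localization of algebras *)

Lemma is_unit_mulI (A : comPzRingType) (u : A) :
  is_unit u -> injective ( *%R u).
Proof.
move=> [v uv] x y e.
by rewrite -[x]mul1r -[y]mul1r -uv mulrAC e mulrAC.
Qed.

Lemma frac_mul_den (k : comPzRingType) (R : comPzAlgType k) (S : mulrClosed R)
    (a : R) (s : {s : R | s \in S}) :
  loc_inj S (\val s) * Defs.frac a s = loc_inj S a.
Proof. by rewrite fracM; apply: frac_eq => /=; ring. Qed.

Lemma loc_inj_unit (k : comPzRingType) (R : comPzAlgType k) (S : mulrClosed R)
    (s : R) : s \in S -> is_unit (loc_inj S s).
Proof.
move=> Ss; exists (Defs.frac 1 (exist _ s Ss)).
by rewrite (frac_mul_den _ (exist _ s Ss)) rmorph1.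
Qed.

(** The value x of an extension at a / s is the unique solution of
f s * x = f a, so an identity between such values holds as soon as it holds
after multiplication by the images of the denominators. *)
Lemma loc_universal (k : comPzRingType) (R R' : comPzAlgType k)
    (S : mulrClosed R) (f : {rmorphism R -> R'}) :
  scalable f -> (forall s, s \in S -> is_unit (f s)) ->
  exists2 fl : {rmorphism loc S -> R'},
    scalable fl /\ (forall a, fl (loc_inj S a) = f a) &
    forall g : {rmorphism loc S -> R'},
      (forall a, g (loc_inj S a) = f a) -> g =1 fl.
Proof.
move=> fZ fS.
have fI (s : {s : R | s \in S}) := is_unit_mulI (fS _ (valP s)).
have [fl flE] : exists fl : loc S -> R',
    forall a s, f (\val s) * fl (Defs.frac a s) = f a.
  have exinv (s : {s : R | s \in S}) : exists t, f (\val s) * t = 1.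
    exact: fS (valP s).
  have [inv invE] := boolp.choice exinv.
  exists (fun q => f (repr q).1 * inv (repr q).2) => a s.
  have [u Su] := frac_repr a s; case: (repr _) => b t /= e.
  apply: (is_unit_mulI (fS _ Su)).
  rewrite (_ : f u * _ = f (u * (b * \val s)) * inv t).
    by rewrite e !rmorphM -!mulrA invE mulr1.
  by rewrite !rmorphM; ring.
have fl1 a : fl (loc_inj S a) = f a.
  by have := flE a (den1 S); rewrite rmorph1 mul1r.
have [|| F FE] := @rmorphism_of _ _ fl.
- move=> q r; case: (frac_surj q) (frac_surj r) => [[a s] <-] [[b t] <-] /=.
  have -> : Defs.frac a s - Defs.frac b t =
      Defs.frac (a * \val t - b * \val s) (den_mul s t).
    by rewrite -[- Defs.frac b t]/(loc_opp _) loc_oppE fracD mulNr.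
  apply: (fI (den_mul s t)); rewrite flE /= !rmorphB !rmorphM.
  by rewrite -(flE a s) -(flE b t); ring.
- split=> [|q r]; first by rewrite -[1]/(loc_inj S 1) fl1 rmorph1.
  case: (frac_surj q) (frac_surj r) => [[a s] <-] [[b t] <-] /=.
  rewrite fracM; apply: (fI (den_mul s t)); rewrite flE /= !rmorphM.
  by rewrite -(flE a s) -(flE b t); ring.
exists F.
  split=> [c q|a]; last by rewrite FE.
  rewrite !FE; case: (frac_surj q) => [[a s] <-] /=.
  rewrite -[c *: Defs.frac a s]/(loc_scale c _) loc_scaleE; apply: (fI s).
  by rewrite flE fZ -pzscalerAr flE.
move=> g gE q; rewrite FE; case: (frac_surj q) => [[a s] <-] /=.
by apply: (fI s); rewrite flE -gE -rmorphM frac_mul_den gE.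
Qed.

(** * The free Rota-Baxter algebra *)

Section ShaUniversal.
Variables (k : comPzRingType) (lam : k) (A B : comPzAlgType k).
Variables (P : {linear B -> B}) (phi : {rmorphism A -> B}).

(** The equation for a successor degree is forced: in Sha, a (x) y is the
product of a and of the Rota-Baxter operator applied to y. *)
Fixpoint tpow_lift (n : nat) {struct n} : tpow A n -> B :=
  if n is n'.+1 return tpow A n -> B
  then tlift (fun (a : A) (y : tpow A n') => phi a * P (@tpow_lift n' y))
  else phi.

Definition sha_lift (z : Sha A lam) : B := dsum_lift (@tpow_lift) z.

Hypothesis phiZ : scalable phi.

Lemma tpow_lift_bilin n : linear (@tpow_lift n) ->
  bilin (fun (a : A) (y : tpow A n) => phi a * P (tpow_lift y)).
Proof.
move=> lin; split=> [y c a b|a c y y'].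
  by rewrite rmorphD phiZ mulrDl pzscalerAl.
by rewrite lin linearP mulrDr pzscalerAr.
Qed.

Lemma tpow_lift_linear n : linear (@tpow_lift n).
Proof.
elim: n => [|n IH] c x y; first by rewrite /= rmorphD phiZ.
exact: tlift_linear (tpow_lift_bilin IH) c x y.
Qed.

Lemma sha_lift_linear : linear sha_lift.
Proof. exact: dsum_lift_linear tpow_lift_linear. Qed.

Lemma sha_liftD z w : sha_lift (z + w) = sha_lift z + sha_lift w.
Proof. by have := sha_lift_linear 1 z w; rewrite !scale1r. Qed.

Lemma sha_lift0 : sha_lift 0 = 0.
Proof. by apply: (addIr (sha_lift 0)); rewrite -sha_liftD !add0r. Qed.

Lemma sha_liftZ c z : sha_lift (c *: z) = c *: sha_lift z.
Proof. by have := sha_lift_linear c z 0; rewrite sha_lift0 !addr0. Qed.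

Lemma sha_lift_inj a : sha_lift (sha_inj lam a) = phi a.
Proof. by rewrite /sha_lift dsum_lift_in //; apply: tpow_lift_linear. Qed.

Lemma sha_lift_cons a z : sha_lift (sha_cons a z) = phi a * P (sha_lift z).
Proof.
move: z; apply: sha_linear_ext => [c z w|c z w|n x].
- by rewrite (sha_cons_bilin _ _).2 sha_lift_linear.
- by rewrite sha_lift_linear linearP mulrDr pzscalerAr.
rewrite sha_cons_in /sha_lift !dsum_lift_in; try exact: tpow_lift_linear.
by rewrite /= tliftE //; apply/tpow_lift_bilin/tpow_lift_linear.
Qed.

Hypothesis hP : rota_baxter lam P.

(** On pure tensors, by induction on the sum of the degrees: each of the three
products in the mixable shuffle formula has a smaller sum, and the
Rota-Baxter identity of P recombines their images. *)
Lemma sha_liftM z w : sha_lift (z * w) = sha_lift z * sha_lift w.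
Proof.
have pureM N m n (x y : Sha A lam) : (m + n <= N)%N ->
    pure_tens m x -> pure_tens n y ->
    sha_lift (sha_mul x y) = sha_lift x * sha_lift y.
  elim: N m n x y => [|N IH] m n x y hN hx hy;
    case: (pure_tensP hx) hN => [[a ->]|[a [m' [x' [-> hx' ->]]]]] hN;
    case: (pure_tensP hy) hN => [[b ->]|[b [n' [y' [-> hy' ->]]]]] hN //;
    rewrite ?(sha_mul_inj_cons, sha_mul_cons_inj, sha_mul_inj);
    rewrite ?(sha_lift_inj, sha_lift_cons) ?rmorphM ?mulrA //;
    first by rewrite [RHS]mulrAC (mulrC (phi b)).
  rewrite addSn addnS ltnS in hN.
  have hN0 : (m' + n' <= N)%N by apply: ltnW.
  have hN1 : (m' + n'.+1 <= N)%N by rewrite addnS.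
  rewrite sha_mul_cons sha_lift_cons !sha_liftD sha_liftZ.
  rewrite (IH _ _ _ _ hN0 hx' hy').
  rewrite (IH _ _ _ _ hN1 hx' (pure_tens_cons 1 hy')).
  rewrite (IH m'.+1 n' _ _ hN (pure_tens_cons 1 hx') hy').
  rewrite !sha_lift_cons !rmorph1 !mul1r rmorphM -hP.
  by ring.
rewrite -[z * w]/(sha_mul z w).
move: z; apply: sha_ind => [|x y ex ey|m z hz].
- by rewrite (bilin0l (sha_mul_bilin _ _)) sha_lift0 mul0r.
- by rewrite (bilinDl (sha_mul_bilin _ _)) !sha_liftD ex ey mulrDl.
move: w; apply: sha_ind => [|x y ex ey|n w hw].
- by rewrite (bilin0r (sha_mul_bilin _ _)) sha_lift0 mulr0.
- by rewrite (bilinDr (sha_mul_bilin _ _)) !sha_liftD ex ey mulrDr.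
exact: pureM (leqnn _) hz hw.
Qed.

End ShaUniversal.

Lemma sha_op_rota_baxter (k : comPzRingType) (lam : k) (A : comPzAlgType k) :
  rota_baxter lam (@sha_op k A lam).
Proof.
by move=> z w; rewrite -[LHS]/(sha_mul _ _) [LHS]sha_mul_cons mulr1.
Qed.

(** Freeness of Sha.  Uniqueness needs pure tensors only, and there it follows
from a (x) z = a * (1 (x) z), one tensor factor at a time. *)
Lemma sha_universal (k : comPzRingType) (lam : k) (A B : comPzAlgType k)
    (P : {linear B -> B}) (phi : {rmorphism A -> B}) :
  rota_baxter lam P -> scalable phi ->
  exists2 F : {rmorphism Sha A lam -> B},
    rb_morphism (@sha_op k A lam) P F /\ (forall a, F (sha_inj lam a) = phi a) &
    forall G : {rmorphism Sha A lam -> B},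
      rb_morphism (@sha_op k A lam) P G ->
      (forall a, G (sha_inj lam a) = phi a) -> G =1 F.
Proof.
move=> hP phiZ; have [|| F FE] := @rmorphism_of (Sha A lam) B (sha_lift P phi).
- move=> z w; rewrite sha_liftD //; congr (_ + _).
  by rewrite -scaleN1r sha_liftZ // scaleN1r.
- split; last exact: sha_liftM.
  by rewrite -[1]/(sha_inj lam 1) sha_lift_inj // rmorph1.
exists F; first split; first split.
- by move=> c z; rewrite !FE sha_liftZ.
- by move=> z; rewrite !FE sha_lift_cons // rmorph1 mul1r.
- by move=> a; rewrite FE sha_lift_inj.
move=> G [GZ GP] GE z; rewrite FE; move: z; apply: sha_ind.
- by rewrite rmorph0 sha_lift0.
- by move=> z w ez ew; rewrite rmorphD sha_liftD // ez ew.
move=> n z; elim=> {n z} [a|a n z _ IH]; first by rewrite GE sha_lift_inj.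
rewrite sha_lift_cons // -IH -GP -GE -rmorphM.
by rewrite [in LHS]sha_consE.
Qed.

(** * Quotients by Rota-Baxter ideals *)

(** The kernel of a Rota-Baxter morphism is a Rota-Baxter ideal, hence contains
the ideal generated by any of its subsets. *)
Lemma rb_gen_ker (k : comPzRingType) (A B : comPzAlgType k)
    (P : {linear A -> A}) (P' : {linear B -> B}) (F : {rmorphism A -> B})
    (X : set A) : rb_morphism P P' F -> (forall x, X x -> F x = 0) ->
  forall x, rb_gen P X x -> F x = 0.
Proof.
move=> [_ FP] FX x.
have ker0 : F 0 = 0 by rewrite rmorph0.
have kerD y z : F y = 0 -> F z = 0 -> F (y + z) = 0.
  by move=> y0 z0; rewrite rmorphD y0 z0 addr0.
have kerM a y : F y = 0 -> F (a * y) = 0.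
  by move=> y0; rewrite rmorphM y0 mulr0.
have kerP y : F y = 0 -> F (P y) = 0 by move=> y0; rewrite FP y0 linear0.
by move/(_ (RBIdeal ker0 kerD kerM kerP)); apply.
Qed.

(** Stated on the bundled linear map, the form in which the operator occurs in
[rota_baxter] and [rb_morphism]. *)
Lemma rb_quot_op_pi (k : comPzRingType) (A : comPzAlgType k)
    (P : {linear A -> A}) (I : rb_ideal P) (x : A) :
  (@rb_quot_op _ _ _ I : {linear rb_quot I -> rb_quot I}) (rb_pi I x) =
  rb_pi I (P x).
Proof. exact: rb_quot_opE. Qed.

Lemma rb_quot_universal (k : comPzRingType) (A B : comPzAlgType k)
    (P : {linear A -> A}) (P' : {linear B -> B}) (I : rb_ideal P)
    (F : {rmorphism A -> B}) :
  rb_morphism P P' F -> (forall x, I x -> F x = 0) ->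
  exists2 G : {rmorphism rb_quot I -> B},
    rb_morphism (@rb_quot_op _ _ _ I) P' G & forall x, G (rb_pi I x) = F x.
Proof.
move=> [FZ FP] FI.
have E x : F (repr (rb_pi I x)) = F x.
  by apply/subr0_eq; rewrite -rmorphB; apply/FI/rbq_reprB.
have [|| G GE] := @rmorphism_of (rb_quot I) B (fun q => F (repr q)).
- move=> q r; case: (rb_pi_surj q) (rb_pi_surj r) => x <- [y <-].
  by rewrite -rmorphB !E rmorphB.
- split=> [|q r]; first by rewrite -(rmorph1 (rb_pi I)) E rmorph1.
  case: (rb_pi_surj q) (rb_pi_surj r) => x <- [y <-].
  by rewrite -rmorphM !E rmorphM.
exists G => [|x]; last by rewrite GE E.
split=> [c q|q]; case: (rb_pi_surj q) => x <-.
  by rewrite -rb_pi_scalable !GE !E FZ.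
by rewrite !GE rb_quot_op_pi !E FP.
Qed.

Lemma rota_baxter_quot (k : comPzRingType) (lam : k) (A : comPzAlgType k)
    (P : {linear A -> A}) (I : rb_ideal P) :
  rota_baxter lam P -> rota_baxter lam (@rb_quot_op _ _ _ I).
Proof.
move=> hP q r; case: (rb_pi_surj q) (rb_pi_surj r) => x <- [y <-] /=.
rewrite (rb_quot_op_pi I x) (rb_quot_op_pi I y) -rmorphM hP.
rewrite -[LHS](rb_quot_op_pi I).
by rewrite !rmorphD [X in _ + X]rb_pi_scalable !rmorphM.
Qed.

(** * Rota-Baxter localization *)

Lemma is_unit_rmorph (A B : comPzRingType) (f : {rmorphism A -> B}) (x : A) :
  is_unit x -> is_unit (f x).
Proof. by move=> [y xy]; exists (f y); rewrite -rmorphM xy rmorph1. Qed.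

Lemma sha_cons1_inj (k : comPzRingType) (lam : k) (A : comPzAlgType k) (a : A) :
  dsum_in (V := tpow A) (m := 1) (tpure (1 : A) a) =
    sha_op (sha_inj lam a).
Proof. by rewrite -[RHS]/(sha_cons 1 _) sha_cons_in. Qed.

Theorem theorem2p4 (k : comPzRingType) (lam : k) (R : comPzAlgType k)
    (P : {linear R -> R}) (hP : rota_baxter lam P) (S : mulrClosed R) :
  is_rb_localization lam P S (sha_loc_op lam P S) (sha_loc_inj lam P S).
Proof.
split.
- exact/rota_baxter_quot/sha_op_rota_baxter.
- split=> [c a|a] /=.
    by rewrite loc_inj_scalable sha_inj_scalable rb_pi_scalable.
  (* i (P a) - P (i a) is the class of a generator of the ideal. *)
  rewrite rb_quot_op_pi; apply/rb_piP => J; apply.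
  by exists a; rewrite (sha_cons1_inj lam).
- move=> s /(@loc_inj_unit _ _ S)/(is_unit_rmorph (@sha_inj k (loc S) lam)).
  exact: is_unit_rmorph.
move=> R' P' f hP' [fZ fP] fS.
have [fl [flZ flE] fl_uniq] := loc_universal fZ fS.
have [F [hF FE] F_uniq] := sha_universal hP' flZ.
have [|G hG GE] := rb_quot_universal (I := sha_loc_ideal lam P S) hF.
  apply: (rb_gen_ker hF) => _ [a ->].
  by rewrite (sha_cons1_inj lam) rmorphB hF.2 !FE !flE fP subrr.
exists G; first by split=> // a; rewrite /= GE FE flE.
move=> g [gZ gP] gE q; case: (rb_pi_surj q) => z <-; rewrite GE.
pose gpi : {rmorphism _ -> _} := g \o rb_pi (sha_loc_ideal lam P S).
apply: (F_uniq gpi) => [|b]; first split.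
- by move=> c y; rewrite /= rb_pi_scalable gZ.
- by move=> y; rewrite /= -gP rb_quot_op_pi.
(* On the image of S^-1 R uniqueness is that of the localization. *)
exact: (fl_uniq (gpi \o @sha_inj k (loc S) lam) gE b).
Qed.
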